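(* Let $\tau^0,\tau^1$ be generalized patterns with no hyphens, let $\tau=\tau^0\mbox{-}\tau^1$ be the multi-pattern formed from them, and let $\phi=f_1(\tau^0)\mbox{-}f_2(\tau^1)$, where $f_1$ and $f_2$ are any trivial bijections. Then $\tau\equiv\phi$.
   Context: $[k]^n$ = words of length $n$ over $\{1,\dots,k\}$. A generalized pattern with no hyphens is a word over $[m]$ using every letter of $[m]$. A multi-pattern $\tau^0\mbox{-}\tau^1\mbox{-}\cdots\mbox{-}\tau^s$ (each $\tau^i$ a generalized pattern with no hyphens) is the pattern obtained by concatenating the $\tau^i$ with hyphens between consecutive blocks, where letters within a block are ordered as usual and every letter of $\tau^i$ is incomparable with every letter of $\tau^j$ for $i\ne j$. A word $\sigma$ contains it if $\sigma$ has occurrences (as factors of consecutive letters, order-isomorphic to the block, with equalities preserved) of $\tau^0,\tau^1,\dots,\tau^s$ in this left-to-right order, pairwise non-overlapping; otherwise $\sigma$ avoids it. Two patterns are equivalent ($\equiv$) if for every $k$ and $n$ the numbers of words in $[k]^n$ avoiding them are equal. Trivial bijections are the reverse $R(\sigma_1\cdots\sigma_n)=\sigma_n\cdots\sigma_1$, the complement $C$ (replacing each letter $a$ by $M+1-a$, $M$ the largest letter of the alphabet / of the pattern), and $R\circ C$. *)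

(* Defs.v *)
From mathcomp Require Import all_boot.

Set Implicit Arguments.
Unset Strict Implicit.
Unset Printing Implicit Defensive.

Definition hyphenfree_pattern (t : seq nat) : Prop :=
  exists m : nat, forall a : nat, (a \in t) = (1 <= a <= m).

Definition max_letter (t : seq nat) : nat := \max_(a <- t) a.

Definition pat_reverse (t : seq nat) : seq nat := rev t.

Definition pat_complement (t : seq nat) : seq nat :=
  [seq (max_letter t).+1 - a | a <- t].

Definition trivial_bijection (f : seq nat -> seq nat) : Prop :=
  [\/ f = pat_reverse, f = pat_complement | f = pat_reverse \o pat_complement].

Definition order_isomorphic (s t : seq nat) : bool :=
  (size s == size t) &&
  [forall i : 'I_(size s), forall j : 'I_(size s),
     ((nth 0 s i < nth 0 s j) == (nth 0 t i < nth 0 t j)) &&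
     ((nth 0 s i == nth 0 s j) == (nth 0 t i == nth 0 t j))].

Definition occurs_at (t w : seq nat) (i : nat) : bool :=
  (i + size t <= size w) && order_isomorphic t (take (size t) (drop i w)).

(* A multi-pattern is the sequence of its blocks. Letters of different blocks
   are incomparable, so the only condition relating two blocks is that the
   factor matched by the earlier one ends before that matched by the later. *)
Definition contains (p : seq (seq nat)) (w : seq nat) : bool :=
  [exists pos : {ffun 'I_(size p) -> 'I_(size w).+1},
     [forall j : 'I_(size p), occurs_at (nth [::] p j) w (pos j)] &&
     [forall j : 'I_(size p), forall l : 'I_(size p),
        (j < l) ==> (pos j + size (nth [::] p j) <= pos l)]].

(* Words in [k]^n are tuples over 'I_k, with i : 'I_k standing for i + 1. *)
Definition word_letters (k n : nat) (w : n.-tuple 'I_k) : seq nat :=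
  [seq (val i).+1 | i <- w].

Definition avoiders (k n : nat) (p : seq (seq nat)) : {set n.-tuple 'I_k} :=
  [set w : n.-tuple 'I_k | ~~ contains p (word_letters w)].

Definition pat_equiv (p q : seq (seq nat)) : Prop :=
  forall k n : nat, #|avoiders k n p| = #|avoiders k n q|.

(* Main.v *)
Require Import Defs.
From mathcomp Require Import all_boot zify.

(** Write a word containing [t0-t1] as [u ++ v], with [u] its shortest prefix
    containing [t0]; then [v] contains [t1].  A word of length [j + 1] contains
    [t0] either within its first [j] letters or for the first time at its last
    one, so the number of possible [u] of each length is determined by the
    numbers of words containing [t0].  Hence the number of words containing
    [t0-t1] depends only on the numbers of words containing [t0] and [t1]
    separately, and these are invariant under reversal and complementation. *)

Set Implicit Arguments.
Unset Strict Implicit.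
Unset Printing Implicit Defensive.

(** * Counting words *)

Definition nwords (T : finType) (n : nat) (P : pred (seq T)) : nat :=
  #|[set w : n.-tuple T | P w]|.

Lemma eq_nwords (T : finType) n (P Q : pred (seq T)) :
  (forall w, size w = n -> P w = Q w) -> nwords n P = nwords n Q.
Proof.
by move=> PQ; apply: eq_card => w; rewrite !inE PQ // size_tuple.
Qed.

Lemma nwordsC (T : finType) n (P : pred (seq T)) :
  nwords n (predC P) = #|T| ^ n - nwords n P.
Proof.
rewrite -card_tuple /nwords -(cardsC [set w : n.-tuple T | P w]) addKn.
by apply: eq_card => w; rewrite !inE.
Qed.

Lemma nwordsU (T : finType) n (P Q : pred (seq T)) :
  (forall w, size w = n -> P w -> ~~ Q w) ->
  nwords n (predU P Q) = nwords n P + nwords n Q.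
Proof.
move=> PQ; rewrite /nwords -cardsUI addnC.
rewrite (_ : _ :&: _ = set0) ?cards0 ?add0n.
  by apply: eq_card => w; rewrite !inE.
apply/setP => w; rewrite !inE; apply/negP => /andP[/PQ/negP]; apply.
by rewrite size_tuple.
Qed.

Lemma nwords0 (T : finType) (P : pred (seq T)) : nwords 0 P = P [::].
Proof.
rewrite /nwords; case: (boolP (P [::])) => h.
  rewrite -[RHS](card_tuple 0 T) -cardsT; apply: eq_card => w.
  by rewrite !inE tuple0.
by apply: eq_card0 => w; rewrite !inE tuple0; exact: negbTE.
Qed.

Lemma nwordsS (T : finType) n (P : pred (seq T)) :
  nwords n.+1 P = \sum_(x : T) nwords n (fun w => P (x :: w)).
Proof.
rewrite /nwords -sum1dep_card.
under [RHS]eq_bigr => x _ do rewrite -sum1dep_card.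
rewrite pair_big_dep /=.
rewrite (reindex (fun p : T * n.-tuple T => [tuple of p.1 :: p.2])) //=.
exists (fun w : n.+1.-tuple T => (thead w, [tuple of behead w])).
  by case=> x w _; congr pair; apply/val_inj.
by move=> w _; rewrite [RHS]tuple_eta; apply/val_inj.
Qed.

(** Prefix and suffix are chosen independently; the induction peels off the first letter, which
    changes only [P]. Every product of counts below comes from here. *)
Lemma nwords_cat (T : finType) m p (P Q : pred (seq T)) :
  nwords (m + p) (fun w => P (take m w) && Q (drop m w))
  = nwords m P * nwords p Q.
Proof.
elim: m P => [|m IHm] P.
  rewrite nwords0 add0n.
  under eq_nwords => w _ do rewrite take0 drop0.
  case: (P [::]); first by rewrite mul1n.
  by apply: eq_card0 => w; rewrite !inE.
rewrite addSn !nwordsS big_distrl; apply: eq_bigr => x _ /=.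
exact: (IHm (fun w => P (x :: w))).
Qed.

Lemma nwords_bij (T : finType) n (f : n.-tuple T -> n.-tuple T)
    (P Q : pred (seq T)) :
  injective f -> (forall w : n.-tuple T, Q (f w) = P w) ->
  nwords n P = nwords n Q.
Proof.
move=> f_inj fP; rewrite /nwords -[RHS](on_card_preimset (f := f)).
  by apply: eq_card => w; rewrite !inE fP.
exact/onW_bij/injF_bij.
Qed.

(** * First occurrences and admissible cuts *)

Section FirstOccurrence.

Variable T : finType.
Implicit Types (P Q : pred (seq T)) (w : seq T).

(** The bound [j] on the cut is kept apart from the length of [w], so that the count can be built up
    by induction on [j] for words of a fixed length. *)
Definition splits P Q (j : nat) w : bool :=
  has (fun m => P (take m w) && Q (drop m w)) (iota 0 j.+1).

Definition prefix_mono P := forall u v, P u -> P (u ++ v).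
Definition suffix_mono P := forall u v, P v -> P (u ++ v).
(** Meant for words of length [j + 1] and [prefix_mono] predicates: no proper prefix satisfies
    [P]. *)
Definition first_at P (j : nat) w := ~~ P (take j w) && P w.

Lemma prefix_mono_take P i j w :
  prefix_mono P -> i <= j -> P (take i w) -> P (take j w).
Proof. by move=> mP ij; rewrite -(subnKC ij) takeD; exact: mP. Qed.

Lemma suffix_mono_drop Q i j w :
  suffix_mono Q -> i <= j -> Q (drop j w) -> Q (drop i w).
Proof.
move=> mQ ij; rewrite -(cat_take_drop (j - i) (drop i w)) drop_drop subnK //.
exact: mQ.
Qed.

(** The subtracted term counts the words whose first [j] letters already satisfy [P]: their last
    letter is free, and by monotonicity they all satisfy [P]. *)
Lemma nwords_first_at P j :
  prefix_mono P ->
  nwords j.+1 (first_at P j) = nwords j.+1 P - nwords j P * #|T|.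
Proof.
move=> mP.
have -> : nwords j P * #|T| = nwords j.+1 (fun w => P (take j w)).
  rewrite -addn1 -[#|T|]expn1 -(card_tuple 1 T) -cardsT.
  have -> : #|[set: 1.-tuple T]| = @nwords T 1 predT.
    by apply: eq_card => w; rewrite !inE.
  by rewrite -nwords_cat; apply: eq_nwords => w _; rewrite andbT.
rewrite (@eq_nwords _ _ P (predU (fun w => P (take j w)) (first_at P j))).
  by rewrite nwordsU ?addKn // => w _; rewrite /first_at => ->.
move=> w sw; rewrite /= /first_at; case: (boolP (P (take j w))) => //= Pj.
by rewrite -(cat_take_drop j w) mP.
Qed.

(** If [P] already holds on the first [j] letters, a cut at [j + 1] gives nothing new: moving it
    back to [j] lengthens the suffix, which keeps [Q]. *)
Lemma splitsS P Q j w :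
  prefix_mono P -> suffix_mono Q ->
  splits P Q j.+1 w
  = splits P Q j w || (first_at P j (take j.+1 w) && Q (drop j.+1 w)).
Proof.
move=> mP mQ; rewrite /splits -[j.+2]addn1 iotaD has_cat has_seq1 add0n.
rewrite /first_at take_takel //.
case: (boolP (P (take j w))) => // Pj.
rewrite [RHS]orbF; apply/orb_idr => /andP[_ Qj].
apply/hasP; exists j; first by rewrite mem_iota add0n leq0n ltnSn.
by rewrite Pj (suffix_mono_drop mQ (leqnSn j)).
Qed.

Lemma nwords_splitsS P Q j n :
  prefix_mono P -> suffix_mono Q -> j < n ->
  nwords n (splits P Q j.+1)
  = nwords n (splits P Q j)
    + (nwords j.+1 P - nwords j P * #|T|) * nwords (n - j.+1) Q.
Proof.
move=> mP mQ jn; rewrite -nwords_first_at // -nwords_cat subnKC //.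
rewrite -nwordsU; first by apply: eq_nwords => w _; exact: splitsS.
(* The two cases are disjoint: a cut at some [m <= j] forces [P] on the first [j] letters, which
   [first_at] forbids. *)
move=> w _ /hasP[m]; rewrite mem_iota add0n /= ltnS => mj /andP[Pm _].
by rewrite /first_at take_takel // (prefix_mono_take mP mj).
Qed.

End FirstOccurrence.

(** The recursion in [j] involves [P] and [Q] only through their separate counts, so each can be
    replaced independently. *)
Lemma nwords_splits_eq (T : finType) (P P' Q Q' : pred (seq T)) :
  prefix_mono P -> prefix_mono P' -> suffix_mono Q -> suffix_mono Q' ->
  (forall n, nwords n P = nwords n P') ->
  (forall n, nwords n Q = nwords n Q') ->
  forall n, nwords n (splits P Q n) = nwords n (splits P' Q' n).
Proof.
move=> mP mP' mQ mQ' PP' QQ' n.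
suff: forall j, j <= n -> nwords n (splits P Q j) = nwords n (splits P' Q' j).
  exact.
elim=> [_|j IHj jn]; last by rewrite !nwords_splitsS // IHj ?PP' ?QQ' // ltnW.
have splits0 (A B : pred (seq T)) :
    nwords n (splits A B 0) = nwords 0 A * nwords n B.
  by rewrite -nwords_cat; apply: eq_nwords => w _; exact: orbF.
by rewrite !splits0 PP' QQ'.
Qed.

(** * Occurrences of a block *)

(** Strict comparisons suffice: two letters are equal exactly when neither is below the other. *)
Lemma order_isomorphicP (s t : seq nat) :
  reflect (size s = size t /\
           forall i j, i < size s -> j < size s ->
             (nth 0 s i < nth 0 s j) = (nth 0 t i < nth 0 t j))
          (order_isomorphic s t).
Proof.
apply: (iffP andP) => [[/eqP st /forallP iso]|[st iso]].
  split=> // i j si sj.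
  by have /forallP/(_ (Ordinal sj))/andP[/eqP] := iso (Ordinal si).
split; first exact/eqP.
apply/forallP => i; apply/forallP => j.
have ltE := iso _ _ (ltn_ord i) (ltn_ord j).
have gtE := iso _ _ (ltn_ord j) (ltn_ord i).
have eqE a b : (a == b :> nat) = ~~ (a < b) && ~~ (b < a) by lia.
by rewrite (eqE (nth 0 s i)) (eqE (nth 0 t i)) ltE gtE !eqxx.
Qed.

Lemma order_isomorphic_rev (s t : seq nat) :
  order_isomorphic (rev s) (rev t) = order_isomorphic s t.
Proof.
have imp u v : order_isomorphic u v -> order_isomorphic (rev u) (rev v).
  move/order_isomorphicP => [uv iso]; apply/order_isomorphicP.
  rewrite !size_rev; split=> // i j iu ju.
  by rewrite !nth_rev -?uv // iso // -subSn // subSS leq_subr.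
by apply/idP/idP => /imp //; rewrite !revK.
Qed.

(** Restricted to the letters of [s] because truncated subtraction reverses the order only below its
    top value. *)
Definition antitone_on (s : seq nat) (g : nat -> nat) :=
  {in s &, forall a b, (g a < g b) = (b < a)}.

Lemma order_isomorphic_map (s t : seq nat) (g h : nat -> nat) :
  antitone_on s g -> antitone_on t h ->
  order_isomorphic (map g s) (map h t) = order_isomorphic s t.
Proof.
move=> gs ht; apply/order_isomorphicP/order_isomorphicP; rewrite !size_map.
  (* Both maps reverse comparisons, hence the swapped indices. *)
  move=> [st iso]; split=> // i j si sj; have := iso j i sj si.
  by rewrite !(nth_map 0) -?st // gs ?mem_nth // ht ?mem_nth -?st.
move=> [st iso]; split=> // i j si sj.
by rewrite !(nth_map 0) -?st // gs ?mem_nth // ht ?mem_nth -?st // iso.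
Qed.

Definition occurs (t w : seq nat) : bool :=
  has (occurs_at t w) (iota 0 (size w).+1).

(** The factorization form treats both ends of the word alike, which suits concatenation and
    reversal. *)
Lemma occursP (t w : seq nat) :
  reflect (exists u v x, w = u ++ v ++ x /\ order_isomorphic t v) (occurs t w).
Proof.
apply: (iffP hasP) => [[i _ /andP[_ iso]]|[u [v [x [-> iso]]]]].
  exists (take i w), (take (size t) (drop i w)), (drop (size t) (drop i w)).
  by rewrite !cat_take_drop.
have [tv _] := order_isomorphicP _ _ iso; exists (size u).
  by rewrite mem_iota !size_cat; lia.
by rewrite /occurs_at drop_size_cat // tv take_size_cat // iso !size_cat; lia.
Qed.

Lemma occurs_catl (t u w : seq nat) : occurs t w -> occurs t (u ++ w).
Proof.
move/occursP => [a [v [x [-> iso]]]]; apply/occursP.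
by exists (u ++ a), v, x; rewrite catA.
Qed.

Lemma occurs_catr (t u w : seq nat) : occurs t w -> occurs t (w ++ u).
Proof.
move/occursP => [a [v [x [-> iso]]]]; apply/occursP.
by exists a, v, (x ++ u); rewrite !catA.
Qed.

Lemma occurs_rev (t w : seq nat) : occurs (rev t) (rev w) = occurs t w.
Proof.
have imp a b : occurs a b -> occurs (rev a) (rev b).
  move/occursP => [u [v [x [-> iso]]]]; apply/occursP.
  exists (rev x), (rev v), (rev u).
  by rewrite !rev_cat catA order_isomorphic_rev.
by apply/idP/idP => /imp //; rewrite !revK.
Qed.

Lemma occurs_map (t w : seq nat) (g h : nat -> nat) :
  antitone_on t g -> antitone_on w h ->
  occurs (map g t) (map h w) = occurs t w.
Proof.
move=> gt hw; rewrite /occurs size_map; apply: eq_has => i.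
rewrite /occurs_at !size_map -map_drop -map_take order_isomorphic_map //.
by move=> a b /mem_take/mem_drop aw /mem_take/mem_drop bw; exact: hw.
Qed.

(** The pattern is complemented with respect to its own largest letter and the word with respect to
    [k]; only the reversal of order matters, so the two tops may differ. *)
Lemma occurs_complement k (t w : seq nat) :
  {in w, forall a, a <= k} ->
  occurs (pat_complement t) [seq k.+1 - a | a <- w] = occurs t w.
Proof.
move=> wk; apply: occurs_map => a b.
  have le_max c : c \in t -> c <= max_letter t.
    by move=> ct; exact: (leq_bigmax_seq (F := id) (P := predT)).
  by move=> /le_max ? /le_max ?; lia.
by move=> /wk ? /wk ?; lia.
Qed.

Lemma contains2E (t0 t1 w : seq nat) :
  contains [:: t0; t1] w
  = has (fun m => occurs t0 (take m w) && occurs t1 (drop m w))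
        (iota 0 (size w).+1).
Proof.
apply/existsP/hasP => [[pos /andP[/forallP occ /forallP sep]]|[m]].
  have /andP[le0 iso0] : occurs_at t0 w (pos ord0) := occ ord0.
  have /andP[le1 iso1] : occurs_at t1 w (pos ord_max) := occ ord_max.
  have pos01 : pos ord0 + size t0 <= pos ord_max.
    exact: (forallP (sep ord0) ord_max).
  (* The cut is placed right after the occurrence of [t0]. *)
  exists (pos ord0 + size t0); first by rewrite mem_iota; lia.
  apply/andP; split; apply/occursP.
    exists (take (pos ord0) w), (take (size t0) (drop (pos ord0) w)), [::].
    by rewrite cats0 -takeD.
  set m := _ + _ in pos01 *.
  exists (take (pos ord_max - m) (drop m w)),
         (take (size t1) (drop (pos ord_max) w)),
         (drop (size t1) (drop (pos ord_max) w)).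
  have dropE : drop (pos ord_max - m) (drop m w) = drop (pos ord_max) w.
    by rewrite drop_drop subnK.
  by split=> //; rewrite cat_take_drop -dropE cat_take_drop.
rewrite mem_iota add0n /= ltnS => mw /andP[/occursP[u0 [v0 [x0 [e0 iso0]]]]].
move=> /occursP[u1 [v1 [x1 [e1 iso1]]]].
have [s0 _] := order_isomorphicP _ _ iso0.
have [s1 _] := order_isomorphicP _ _ iso1.
have := size_takel mw; rewrite e0 !size_cat => sm.
have := size_drop m w; rewrite e1 !size_cat => sd.
have wE : w = u0 ++ v0 ++ x0 ++ u1 ++ v1 ++ x1.
  by rewrite -[LHS](cat_take_drop m) e0 e1 !catA.
(* The prefix [u1] is measured inside [drop m w], so the second position is shifted by [m]. *)
exists [ffun j : 'I_2 => if j == ord0 then inord (size u0)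
                         else inord (m + size u1)].
have p0 : size u0 < (size w).+1 by lia.
have p1 : m + size u1 < (size w).+1 by lia.
apply/andP; split; apply/forallP.
  case=> [[|[|//]]] lt_j; rewrite ffunE /= inordK //.
    rewrite /occurs_at wE drop_size_cat // s0 take_size_cat // iso0.
    by rewrite !size_cat; lia.
  rewrite /occurs_at [m + size u1]addnC -drop_drop e1 drop_size_cat //.
  by rewrite s1 take_size_cat // iso1; lia.
case=> [[|[|//]]] lt_j; apply/forallP => -[[|[|//]]] lt_l //.
by rewrite !ffunE /= !inordK //; lia.
Qed.

(** * Equivalence of multi-patterns *)

Definition word_occurs (k : nat) (t : seq nat) (w : seq 'I_k) : bool :=
  occurs t [seq (val i).+1 | i <- w].

Lemma card_avoiders2 k n (t0 t1 : seq nat) :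
  #|avoiders k n [:: t0; t1]|
  = #|'I_k| ^ n - nwords n (splits (@word_occurs k t0) (@word_occurs k t1) n).
Proof.
rewrite -nwordsC; apply: eq_card => w; rewrite !inE /=; congr (~~ _).
rewrite contains2E /word_letters size_map size_tuple; apply: eq_has => m.
by rewrite /word_occurs map_take map_drop.
Qed.

Lemma nwords_occurs_reverse k n (t : seq nat) :
  nwords n (@word_occurs k t) = nwords n (@word_occurs k (pat_reverse t)).
Proof.
apply: (@nwords_bij _ _ (fun w => [tuple of rev w])).
  by move=> u v /(congr1 val)/= /(can_inj revK) /val_inj.
by move=> w; rewrite /word_occurs /= map_rev occurs_rev.
Qed.

Lemma nwords_occurs_complement k n (t : seq nat) :
  nwords n (@word_occurs k t) = nwords n (@word_occurs k (pat_complement t)).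
Proof.
apply: (@nwords_bij _ _ (fun w => [tuple of map (@rev_ord k) w])).
  by move=> u v /(congr1 val)/= /(inj_map rev_ord_inj) /val_inj.
move=> w; rewrite /word_occurs /= -[in RHS](@occurs_complement k).
  congr occurs; rewrite -!map_comp; apply: eq_map => i /=.
  (* The index [i] stands for the letter [i + 1], and [rev_ord] sends it to [k - (i + 1)], which
     stands for [k - i = (k + 1) - (i + 1)] because [i < k]. *)
  by have := ltn_ord i; lia.
by move=> a /mapP[i _ ->].
Qed.

Lemma nwords_occurs_trivial k n (f : seq nat -> seq nat) (t : seq nat) :
  trivial_bijection f ->
  nwords n (@word_occurs k t) = nwords n (@word_occurs k (f t)).
Proof.
case=> ->; [exact: nwords_occurs_reverse|exact: nwords_occurs_complement|].
by rewrite /= -nwords_occurs_reverse -nwords_occurs_complement.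
Qed.

Theorem mainTheorem6 (tau0 tau1 : seq nat) (f1 f2 : seq nat -> seq nat)
  (htau0 : hyphenfree_pattern tau0) (htau1 : hyphenfree_pattern tau1)
  (hf1 : trivial_bijection f1) (hf2 : trivial_bijection f2) :
  pat_equiv [:: tau0; tau1] [:: f1 tau0; f2 tau1].
Proof.
move=> k n; rewrite !card_avoiders2; congr (_ - _).
have prefixP t : prefix_mono (@word_occurs k t).
  by move=> u v; rewrite /word_occurs map_cat; exact: occurs_catr.
have suffixP t : suffix_mono (@word_occurs k t).
  by move=> u v; rewrite /word_occurs map_cat; exact: occurs_catl.
by apply: nwords_splits_eq => // m; exact: nwords_occurs_trivial.
Qed.
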